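(* Let $\lambda, \theta_1, \theta_2, \theta_3 \in [0,1]$. Then $$\frac{1}{4} \left( G_\lambda(\theta_1, \theta_2, \theta_3) + G_\lambda(\theta_1, -\theta_2, \theta_3) + G_\lambda(\theta_1, \theta_2, -\theta_3) + G_\lambda(\theta_1, -\theta_2, -\theta_3) \right) \le \lambda \sum_{i=1}^{3} \theta_i \operatorname{arctanh}(\theta_i).$$
   Context: Here $\operatorname{arctanh}(x) = \frac{1}{2} \ln \frac{1+x}{1-x}$ for $x \in (-1,1)$. For $\lambda \in \mathbb{R}$, define $$F_\lambda(t_1, t_2, t_3) := \operatorname{arctanh}\left( \frac{\lambda(t_1 + t_2 + t_3 + t_1 t_2 t_3)}{1 + \lambda(t_1 t_2 + t_2 t_3 + t_3 t_1)} \right),$$ $$G_\lambda(t_1, t_2, t_3) := (t_1 + t_2 + t_3 + t_1 t_2 t_3)\, F_\lambda(t_1, t_2, t_3).$$ Conventions for boundary values: the inequality is read in the extended reals, with $\operatorname{arctanh}(1) = +\infty$, $\operatorname{arctanh}(-1) = -\infty$, and $0 \cdot (\pm\infty) = 0$; moreover $G_\lambda(t_1,t_2,t_3) = 0$ whenever $t_1 + t_2 + t_3 + t_1 t_2 t_3 = 0$ (including when the fraction defining $F_\lambda$ is of the form $0/0$). *)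

(* Defs.v *)
(* MathComp / MathComp-Analysis: the reals are an arbitrary R : realType,
   the extended reals are \bar R. *)
From mathcomp Require Import all_boot all_order all_algebra.
From mathcomp Require Import all_classical all_reals all_analysis.

Set Implicit Arguments.
Unset Strict Implicit.
Unset Printing Implicit Defensive.

Import Order.TTheory GRing.Theory Num.Theory.

Local Open Scope ring_scope.

(* Extended-real valued, with arctanh (+-1) = +-oo. Values at points outside
   [-1, 1] are meaningless. *)
Definition arctanh (R : realType) (x : R) : \bar R :=
  if x == 1 then +oo%E
  else if x == -1 then -oo%E
  else (2^-1 * ln ((1 + x) / (1 - x)))%:E.

Definition Flam (R : realType) (lam t1 t2 t3 : R) : \bar R :=
  arctanh (lam * (t1 + t2 + t3 + t1 * t2 * t3) /
           (1 + lam * (t1 * t2 + t2 * t3 + t3 * t1))).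

(* In \bar R, 0 * x = 0 for every x, infinite or not; hence Glam vanishes
   whenever its first factor does, whatever the value that the total division
   gives to the fraction in Flam (see Glam_eq0). *)
Definition Glam (R : realType) (lam t1 t2 t3 : R) : \bar R :=
  ((t1 + t2 + t3 + t1 * t2 * t3)%:E * Flam lam t1 t2 t3)%E.

Lemma Glam_eq0 (R : realType) (lam t1 t2 t3 : R) :
  t1 + t2 + t3 + t1 * t2 * t3 = 0 -> Glam lam t1 t2 t3 = 0%E.
Proof. by move=> s0; rewrite /Glam s0 mul0e. Qed.

(* Main.v *)
Require Import Defs.
From mathcomp Require Import all_boot all_order all_algebra.
From mathcomp Require Import all_classical all_reals all_analysis.
From mathcomp Require Import ring lra.
Import Order.TTheory GRing.Theory Num.Theory.
Local Open Scope ring_scope.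

(** Write s = t1 + t2 + t3 + t1 t2 t3 and e = t1 t2 + t2 t3 + t3 t1. Then
    1 + e + s and 1 + e - s are the products of the 1 + t_i and of the 1 - t_i,
    and inside the open cube
      G_lam / lam = (s / 2) * (integral of dz / (1 + lam z) from e - s to e + s).
    As 1 / (1 + lam z) is convex in lam, so is G_lam / lam, which therefore lies
    below its chord between lam = 0 and lam = 1 ([Glam_le]):
      G_lam / lam <= (1 - lam) s^2 + lam G_1,
      G_1 = s (arctanh t1 + arctanh t2 + arctanh t3).
    Only the endpoints are then left, after averaging over the signs:
    - at lam = 1 the average of G_1 is exactly the sum of the
      th_i arctanh th_i, because all cross terms cancel;
    - at lam = 0 the average of s^2 is the sum of the th_i^2 plus
      (th1 th2 th3)^2, which is at most the same sum since
      arctanh t >= t + t^3 / 3 ([second_moment_le]).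
    When some th_i is 1 and lam > 0 the right-hand side is infinite, and when
    lam = 0 both sides vanish. *)

Lemma is_derive_ge0_le (R : realType) (f df : R -> R) (a b : R) :
  a <= b ->
  (forall x, a <= x <= b -> is_derive x 1 f (df x)) ->
  (forall x, a <= x <= b -> 0 <= df x) -> f a <= f b.
Proof.
move=> ab fd df0.
have [||c] := @MVT_segment R f df a b ab.
- by move=> x; rewrite in_itv => /andP[ax xb]; apply: fd; rewrite !ltW.
- by apply: derivable_within_continuous => x; rewrite in_itv => /fd[].
rewrite in_itv /= => /df0 c0 eqf.
by rewrite -subr_ge0 eqf mulr_ge0 // subr_ge0.
Qed.

(** Keeping the slope c as a parameter serves both ln (1 + lam z) and the two
    logarithms of arctanh (c = 1 and c = -1). *)
Lemma is_derive_ln1 {R : realType} {c x : R} : 0 < 1 + c * x ->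
  is_derive x 1 (fun y => ln (1 + c * y)) (c / (1 + c * x)).
Proof.
move=> pos.
have daff : is_derive x 1 (fun y => 1 + c * y) c.
  by apply: is_derive_eq; rewrite /GRing.scale /=; ring.
rewrite mulrC.
exact: (@is_derive1_comp R (@ln R) (fun y => 1 + c * y) _ _ _
          (is_derive1_ln pos) daff).
Qed.

(** The finite values of [arctanh], as a difference of logarithms so that it
    can be differentiated and added term by term. *)
Definition artanh {R : realType} (x : R) : R :=
  2^-1 * (ln (1 + x) - ln (1 - x)).

Lemma artanhN (R : realType) (x : R) : artanh (- x) = - artanh x.
Proof. by rewrite /artanh opprK -mulrN opprB. Qed.

Lemma arctanhE (R : realType) (x : R) : -1 < x < 1 ->
  arctanh x = (artanh x)%:E.
Proof.
move=> /andP[xgt xlt].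
rewrite /arctanh /artanh (lt_eqF xlt) (gt_eqF xgt) ln_div // posrE; lra.
Qed.

(** The difference of the two sides vanishes at 0 and has derivative
    1 / (1 - y^2) - (1 + y^2) = y^4 / (1 - y^2). The cubic term is what absorbs
    (th1 th2 th3)^2 in [second_moment_le]. *)
Lemma artanh_ge {R : realType} {x : R} :
  0 <= x < 1 -> x + x ^+ 3 / 3 <= artanh x.
Proof.
move=> /andP[x0 x1].
pose f (y : R) : R :=
  2^-1 * (ln (1 + 1 * y) - ln (1 + (-1) * y)) - (y + 3^-1 * (y * (y * y))).
have : f 0 <= f x.
  pose df (y : R) : R :=
    2^-1 * (1 / (1 + 1 * y) - (-1) / (1 + (-1) * y)) - (1 + y * y).
  apply: (@is_derive_ge0_le R f df _ _ x0) => y /andP[y0 yx].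
    have p1 : 0 < 1 + 1 * y by lra.
    have p2 : 0 < 1 + (-1) * y by lra.
    have d1 := is_derive_ln1 p1; have d2 := is_derive_ln1 p2.
    apply: is_derive_eq; rewrite /df /GRing.scale /=; lra.
  have -> : df y = y ^+ 4 / ((1 + y) * (1 - y)).
    by rewrite /df; field; apply/andP; split; apply/eqP; lra.
  rewrite divr_ge0 ?exprn_ge0 // mulr_ge0 //; lra.
rewrite /f /artanh !mulr0 !mul1r !mulN1r !addr0 ln1 => h; lra.
Qed.

Lemma lam_pos {R : realType} {lam z : R} : 0 <= lam <= 1 -> -1 < z ->
  0 < 1 + lam * z.
Proof.
move=> /andP[l0 l1] z1.
have [->|lam0] := eqVneq lam 0; first by rewrite mul0r addr0.
have : 0 < lam * (1 + z) by rewrite mulr_gt0 ?lt0r ?lam0 //; lra.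
lra.
Qed.

(** Integrated form, over z from a to b and multiplied by lam, of the convexity
    inequality 1 / (1 + lam z) <= (1 - lam) + lam / (1 + z). *)
Lemma ln_chord {R : realType} {lam a b : R} :
  0 <= lam <= 1 -> -1 < a -> a <= b ->
  ln (1 + lam * b) - ln (1 + lam * a) <=
  lam * (1 - lam) * (b - a) + lam ^+ 2 * (ln (1 + b) - ln (1 + a)).
Proof.
move=> hl a1 ab.
pose f (z : R) : R :=
  lam * (1 - lam) * z + lam ^+ 2 * ln (1 + 1 * z) - ln (1 + lam * z).
have : f a <= f b.
  pose df (z : R) : R :=
    lam * (1 - lam) + lam ^+ 2 * (1 / (1 + 1 * z)) - lam / (1 + lam * z).
  apply: (@is_derive_ge0_le R f df _ _ ab) => z /andP[az zb].
    have p1 : 0 < 1 + 1 * z by lra.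
    have p2 : 0 < 1 + lam * z by apply: lam_pos => //; lra.
    have d1 := is_derive_ln1 p1; have d2 := is_derive_ln1 p2.
    by apply: is_derive_eq; rewrite /df /GRing.scale /=; ring.
  have p1 : 0 < 1 + z by lra.
  have p2 : 0 < 1 + lam * z by apply: lam_pos => //; lra.
  have -> : df z = lam ^+ 2 * (1 - lam) * z ^+ 2 / ((1 + z) * (1 + lam * z)).
    by rewrite /df; field; rewrite !gt_eqF.
  move: hl => /andP[l0 l1].
  apply: divr_ge0; last by rewrite ltW // mulr_gt0.
  by apply: mulr_ge0 (sqr_ge0 z); apply: mulr_ge0 (sqr_ge0 lam) _; lra.
rewrite /f !mul1r => h; lra.
Qed.

Section SignedTriple.
Context {R : realType} {lam t1 t2 t3 : R}.
Hypotheses (hlam : 0 <= lam <= 1).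
Hypotheses (h1 : -1 < t1 < 1) (h2 : -1 < t2 < 1) (h3 : -1 < t3 < 1).

Let s := t1 + t2 + t3 + t1 * t2 * t3.
Let e := t1 * t2 + t2 * t3 + t3 * t1.

Let plusE : 1 + (e + s) = (1 + t1) * (1 + t2) * (1 + t3).
Proof. by rewrite /e /s; ring. Qed.

Let minusE : 1 + (e - s) = (1 - t1) * (1 - t2) * (1 - t3).
Proof. by rewrite /e /s; ring. Qed.

Let plus_gt : -1 < e + s.
Proof.
rewrite -subr_gt0 opprK addrC plusE.
by move/andP: h1 => []; move/andP: h2 => []; move/andP: h3 => [] *;
   rewrite !mulr_gt0 //; lra.
Qed.

Let minus_gt : -1 < e - s.
Proof.
rewrite -subr_gt0 opprK addrC minusE.
by move/andP: h1 => []; move/andP: h2 => []; move/andP: h3 => [] *;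
   rewrite !mulr_gt0 //; lra.
Qed.

Lemma FlamE : Flam lam t1 t2 t3 =
  (2^-1 * (ln (1 + lam * (e + s)) - ln (1 + lam * (e - s))))%:E.
Proof.
have pp := lam_pos hlam plus_gt; have pm := lam_pos hlam minus_gt.
have pe : 0 < 1 + lam * e by lra.
have pe0 : 1 + lam * e != 0 by rewrite gt_eqF.
rewrite /Flam -/s -/e arctanhE; last first.
  by rewrite ltr_pdivrMr // ltr_pdivlMr //; apply/andP; split; lra.
rewrite /artanh.
have -> : 1 + lam * s / (1 + lam * e) = (1 + lam * (e + s)) / (1 + lam * e).
  by field.
have -> : 1 - lam * s / (1 + lam * e) = (1 + lam * (e - s)) / (1 + lam * e).
  by field.
rewrite !ln_div ?posrE //; congr (_ %:E); lra.
Qed.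

(** The chord bound [ln_chord] on the interval between e - s and e + s. At the
    endpoint lam = 1 the two logarithms split into the artanh t_i. *)
Lemma Glam_le :
  exists2 g : R, Glam lam t1 t2 t3 = g%:E &
    g <= lam * (1 - lam) * s ^+ 2 +
         lam ^+ 2 * (s * (artanh t1 + artanh t2 + artanh t3)).
Proof.
rewrite /Glam FlamE -/s -EFinM; eexists; first by [].
have sumL : 2 * (artanh t1 + artanh t2 + artanh t3) =
    ln (1 + (e + s)) - ln (1 + (e - s)).
  move/andP: h1 => [? ?]; move/andP: h2 => [? ?]; move/andP: h3 => [? ?].
  rewrite plusE minusE !lnM ?posrE ?mulr_gt0 //; try lra.
  by rewrite /artanh; lra.
(* The factor s of G_lam turns negative exactly when the interval is reversed. *)
have [s0|s0] := leP 0 s.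
  have es : e - s <= e + s by lra.
  have := ler_wpM2l s0 (ln_chord hlam minus_gt es).
  rewrite -sumL => h; lra.
have es : e + s <= e - s by lra.
have s0' : 0 <= - s by lra.
have := ler_wpM2l s0' (ln_chord hlam plus_gt es).
have -> : ln (1 + (e - s)) - ln (1 + (e + s)) =
    - (2 * (artanh t1 + artanh t2 + artanh t3)) by rewrite sumL opprB.
move=> h; lra.
Qed.

End SignedTriple.

(** The left-hand side is the average of (x + y + z + x y z)^2 over the signs of
    y and z, the slope of the averaged G_lam at lam = 0. With
    t artanh t >= t^2 + t^4 / 3, it remains to bound (x y z)^2 by the mean of
    the fourth powers. *)
Lemma second_moment_le {R : realType} {x y z : R} :
  0 <= x < 1 -> 0 <= y < 1 -> 0 <= z < 1 ->
  x ^+ 2 + y ^+ 2 + z ^+ 2 + (x * y * z) ^+ 2 <=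
  x * artanh x + y * artanh y + z * artanh z.
Proof.
move=> hx hy hz.
have lower (t : R) : 0 <= t < 1 -> t ^+ 2 + t ^+ 4 / 3 <= t * artanh t.
  move=> ht; have /andP[t0 _] := ht.
  by apply: le_trans (ler_wpM2l t0 (artanh_ge ht)); lra.
have := lower _ hx; have := lower _ hy; have := lower _ hz.
suff : (x * y * z) ^+ 2 <= (x ^+ 4 + y ^+ 4 + z ^+ 4) / 3 by lra.
have sq (t : R) : 0 <= t < 1 -> 0 <= t ^+ 2 <= 1.
  by move=> /andP[t0 t1]; rewrite sqr_ge0 expr_le1 // ltW.
have amgm (a b c : R) : 0 <= a <= 1 -> 0 <= b <= 1 -> 0 <= c <= 1 ->
    a * b * c <= (a ^+ 2 + b ^+ 2 + c ^+ 2) / 3.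
  move=> /andP[a0 a1] /andP[b0 b1] /andP[c0 c1].
  have abc : a * b * c <= a * b by rewrite ler_piMr // mulr_ge0.
  have bca : a * b * c <= b * c by rewrite -mulrA ler_piMl // mulr_ge0.
  have acb : a * b * c <= a * c by rewrite mulrAC ler_piMr // mulr_ge0.
  have := sqr_ge0 (a - b); have := sqr_ge0 (b - c); have := sqr_ge0 (a - c).
  lra.
have := amgm _ _ _ (sq _ hx) (sq _ hy) (sq _ hz).
lra.
Qed.

Lemma corollary3_interior (R : realType) (lam th1 th2 th3 : R) :
  0 <= lam <= 1 -> 0 <= th1 < 1 -> 0 <= th2 < 1 -> 0 <= th3 < 1 ->
  ((4^-1)%:E * (Glam lam th1 th2 th3 + Glam lam th1 (- th2)%R th3 +
                Glam lam th1 th2 (- th3)%R + Glam lam th1 (- th2)%R (- th3)%R)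
   <= lam%:E * (th1%:E * arctanh th1 + th2%:E * arctanh th2 +
                th3%:E * arctanh th3))%E.
Proof.
move=> hlam h1 h2 h3.
have pm (t : R) : 0 <= t < 1 -> (-1 < t < 1) * (-1 < - t < 1).
  by move=> /andP[t0 t1]; split; apply/andP; split; lra.
have [p1 _] := pm _ h1; have [p2 n2] := pm _ h2; have [p3 n3] := pm _ h3.
have [g1 -> le1] := Glam_le hlam p1 p2 p3.
have [g2 -> le2] := Glam_le hlam p1 n2 p3.
have [g3 -> le3] := Glam_le hlam p1 p2 n3.
have [g4 -> le4] := Glam_le hlam p1 n2 n3.
rewrite !arctanhE // -!EFinM lee_fin.
rewrite !artanhN in le2 le3 le4.
have M := second_moment_le h1 h2 h3.
have /andP[l0 l1] := hlam.
have l2 : 0 <= lam * (1 - lam) by rewrite mulr_ge0 // subr_ge0.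
(* In the sum of the four chord bounds the terms odd in th2 or th3 cancel; what
   is left is the goal up to lam (1 - lam) times M. *)
have := ler_wpM2l l2 M.
by lra.
Qed.

(** Lets one infinite term on the right-hand side make the whole sum +oo. *)
Lemma mul_arctanh_neqNy {R : realType} {t : R} : 0 <= t <= 1 ->
  (t%:E * arctanh t)%E != -oo%E.
Proof.
move=> /andP[t0 t1].
have [->|tn] := eqVneq t 1; first by rewrite /arctanh eqxx mul1e.
rewrite arctanhE; first by rewrite -EFinM.
have : t < 1 by rewrite lt_neqAle tn.
by move=> ->; rewrite andbT; lra.
Qed.

Theorem corollary3 (R : realType) (lam th1 th2 th3 : R)
  (hlam : 0 <= lam <= 1) (hth1 : 0 <= th1 <= 1)
  (hth2 : 0 <= th2 <= 1) (hth3 : 0 <= th3 <= 1) :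
  ((4^-1)%:E * (Glam lam th1 th2 th3 + Glam lam th1 (- th2)%R th3 +
                Glam lam th1 th2 (- th3)%R + Glam lam th1 (- th2)%R (- th3)%R)
   <= lam%:E * (th1%:E * arctanh th1 + th2%:E * arctanh th2 +
                th3%:E * arctanh th3))%E.
Proof.
have [lam0|lam0] := eqVneq lam 0.
  have G0 a b c : Glam lam a b c = 0%E.
    rewrite /Glam /Flam lam0 !mul0r arctanhE; last lra.
    by rewrite /artanh subr0 addr0 subrr mulr0 mule0.
  by rewrite !G0 !adde0 mule0 lam0 mul0e.
have lamp : 0 < lam by rewrite lt_neqAle eq_sym lam0; case/andP: hlam.
have n1 := mul_arctanh_neqNy hth1.
have n2 := mul_arctanh_neqNy hth2.
have n3 := mul_arctanh_neqNy hth3.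
have at1 : (1%:E * arctanh (1 : R))%E = +oo%E by rewrite /arctanh eqxx mul1e.
have lamy : (lam%:E * +oo = +oo)%E by rewrite gt0_muley // lte_fin.
have lt1 (t : R) : 0 <= t <= 1 -> t != 1 -> 0 <= t < 1.
  by move=> /andP[-> t1] tn; rewrite lt_neqAle tn.
have [e1|/(lt1 _ hth1) h1] := eqVneq th1 1.
  by rewrite [in leRHS]e1 at1 addye // addye // lamy leey.
have [e2|/(lt1 _ hth2) h2] := eqVneq th2 1.
  by rewrite [in leRHS]e2 at1 addey // addye // lamy leey.
have [e3|/(lt1 _ hth3) h3] := eqVneq th3 1.
  rewrite [in leRHS]e3 at1 addey ?lamy ?leey //.
  by rewrite adde_eq_ninfty negb_or n1 n2.
exact: corollary3_interior.
Qed.
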